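(* Let $k\ge1$ and $n\ge1$. The descending strictly $k$-Naples parking functions of length $n$ are in bijection with the $(2k+2)$-rooted non-crossing set partitions of $[n+k+1]$ in which $1$ belongs to the root, i.e. the non-crossing set partitions of $\{1,\dots,n+k+1\}$ in which the block containing $1$ has exactly $2k+2$ elements.
   Context: A set partition of $[m]=\{1,\dots,m\}$ is non-crossing if there are no $a<b<c<d$ with $a,c$ in one block and $b,d$ in a different block. An $r$-rooted non-crossing set partition is a non-crossing set partition with a distinguished block (the root) of size $r$. Parking rules: $n$ spots $1,\dots,n$; cars $c_1,\dots,c_n$ arrive in order with preferences $a_j\in[n]$; $k$-Naples rule: $c_j$ parks at $a_j$ if empty, otherwise checks spots $a_j-1,\dots,a_j-k$ (those $\ge1$) in order and parks in the first empty one, otherwise drives forward from $a_j$ and parks in the first empty spot after $a_j$ (failing if none). A preference is $k$-Naples if all cars park ($0$-Naples = ordinary parking functions), and strictly $k$-Naples if it is $k$-Naples but not $(k-1)$-Naples. Descending means weakly decreasing. *)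

(* Defs.v *)
From mathcomp Require Import all_boot.

Set Implicit Arguments.
Unset Strict Implicit.
Unset Printing Implicit Defensive.

(* Spots are numbered from 0: the ordinal i : 'I_n stands for spot i + 1. *)

(* The spots inspected, in order, by a car preferring spot [a]:
   a, then a-1, ..., a-k (as long as they exist), then a+1, ..., n-1. *)
Definition naples_route (k n a : nat) : seq nat :=
  a :: [seq a - i | i <- iota 1 k & i <= a] ++ iota a.+1 (n - a.+1).

Definition naples_spot (k n : nat) (occ : seq nat) (a : nat) : option nat :=
  ohead [seq s <- naples_route k n a | s \notin occ].

Fixpoint all_park (k n : nat) (occ prefs : seq nat) : bool :=
  if prefs is a :: prefs' then
    if naples_spot k n occ a is Some s then all_park k n (s :: occ) prefs'
    else false
  else true.

Definition naples (k n : nat) (t : n.-tuple 'I_n) : bool :=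
  all_park k n [::] [seq val a | a <- t].

(* Meaningful for 0 < k only, because of k.-1. *)
Definition strictly_naples (k n : nat) (t : n.-tuple 'I_n) : bool :=
  naples k t && ~~ naples k.-1 t.

Definition descending (n : nat) (t : n.-tuple 'I_n) : bool :=
  sorted geq [seq val a | a <- t].

Definition noncrossing (m : nat) (P : {set {set 'I_m}}) : bool :=
  [forall B in P, forall C in P, (B != C) ==>
    ~~ [exists a in B, exists b in C, exists c in B, exists d in C,
         [&& a < b, b < c & c < d]]].

Definition nc_partition (m : nat) (P : {set {set 'I_m}}) : bool :=
  partition P [set: 'I_m] && noncrossing P.

(* A partition together with its distinguished block, the root. *)
Definition rooted_nc_partition (r m : nat)
    (Q : {set {set 'I_m}} * {set 'I_m}) : bool :=
  [&& nc_partition Q.1, Q.2 \in Q.1 & #|Q.2| == r].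

Definition desc_strictly_naples (k n : nat) : Type :=
  {t : n.-tuple 'I_n | descending t && strictly_naples k t}.

(* [ord0] is the element 1 of {1, ..., m + 1}. *)
Definition rooted_nc_partition_at_1 (r m : nat) : Type :=
  {Q : {set {set 'I_m.+1}} * {set 'I_m.+1} |
    rooted_nc_partition r Q && (ord0 \in Q.2)}.

(* Main.v *)
(* Both sides are counted. In a weakly decreasing preference sequence
   a_0 >= a_1 >= ... (spots numbered from 0) car j is stuck exactly when
   a_j + j >= n + k, so the strictly k-Naples sequences are those with
   max_j (a_j + j) = n + k - 1; by the reflection principle there are
   C(2n-1, n+k) - C(2n-1, n+k+1) of them. For non-crossing partitions,
   deleting the first point and merging its block with that of the second
   point is a bijection from the partitions of [m+1] whose first block has
   r+1 elements to those of [m] whose first block has at least r elements.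
   This gives a ballot-type recurrence with the same solution. *)

Require Import Defs.
From mathcomp Require Import all_boot zify.

Set Implicit Arguments.
Unset Strict Implicit.
Unset Printing Implicit Defensive.

(** * When a descending preference sequence parks *)

Lemma mem_naples_route (k n a s : nat) :
  a < n -> (s \in naples_route k n a) = (a - k <= s < n).
Proof.
move=> lt_an; rewrite /naples_route inE mem_cat mem_iota.
have -> : (s \in [seq a - i | i <- iota 1 k & i <= a]) = (a - k <= s < a).
  apply/mapP/idP => [[i]|].
    rewrite mem_filter mem_iota; lia.
  move=> /andP[le_s lt_s]; exists (a - s); last by lia.
  rewrite mem_filter mem_iota; lia.
lia.
Qed.

Lemma naples_spotP (k n : nat) (occ : seq nat) (a : nat) : a < n ->
  match naples_spot k n occ a with
  | Some s => a - k <= s < n /\ s \notin occ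
  | None => forall s, a - k <= s < n -> s \in occ
  end.
Proof.
move=> lt_an; rewrite /naples_spot.
case E: [seq _ <- _ | _] => [|s l] /=.
  move=> s; rewrite -mem_naples_route // => s_in; apply/negPn/negP => s_out.
  by have := mem_filter (fun s => s \notin occ) s (naples_route k n a);
     rewrite E s_in s_out.
have := mem_filter (fun s => s \notin occ) s (naples_route k n a).
by rewrite E mem_head mem_naples_route // => /esym/andP[].
Qed.

(* [below b s] says that s_j + j < b for every j < size s. *)
Fixpoint below (b : nat) (s : seq nat) : bool :=
  if s is a :: s' then (a < b) && below b.-1 s' else true.

Lemma below_leq (b c : nat) (s : seq nat) : b <= c -> below b s -> below c s.
Proof.
elim: s b c => //= a s IHs b c le_bc /andP[lt_ab bs].
rewrite (leq_trans lt_ab le_bc) (IHs b.-1) //; lia.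
Qed.

(* Every car so far has parked at distance at most k below the preference of
   the next car, so the spots from a - k on hold all parked cars: the next
   car is stuck precisely when they are full. *)
Lemma all_parkE (k n : nat) (prefs occ : seq nat) :
    uniq occ -> all (gtn n) occ -> sorted geq prefs -> all (gtn n) prefs ->
    {in prefs & occ, forall a s, a <= s + k} ->
    size occ + size prefs <= n ->
  all_park k n occ prefs = below (n + k - size occ) prefs.
Proof.
elim: prefs occ => //= a prefs IH occ uo no sp /andP[lt_an np] po sz.
have size_ge m (s : seq nat) : {subset iota m (n - m) <= s} -> n - m <= size s.
  by move=> sub; rewrite -(size_iota m (n - m)) uniq_leq_size ?iota_uniq.
have size_le m (s : seq nat) : uniq s -> {subset s <= iota m (n - m)} ->
    size s <= n - m.
  by move=> us sub; rewrite -(size_iota m (n - m)) uniq_leq_size.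
have := naples_spotP k occ lt_an.
case: naples_spot => [s [/andP[les lts] so]|full].
  have [pa sp'] : all (geq a) prefs /\ sorted geq prefs.
    by move: sp; rewrite path_sortedE => [/andP[]|x y z /=]; last lia.
  rewrite IH //=.
  (* The parked cars, the new one included, occupy distinct spots in [[a - k, n)]; counting them
     gives [a + size occ < n + k]. *)
  - have := size_le (a - k) (s :: occ).
    have -> : n + k - (size occ).+1 = (n + k - size occ).-1 by lia.
    suff sub : {subset s :: occ <= iota (a - k) (n - (a - k))}.
      rewrite /= so uo => /(_ isT sub) szo.
      have -> // : a < n + k - size occ by lia.
    move=> x; rewrite inE mem_iota => /orP[/eqP->|xo]; first by lia.
    have := po a x (mem_head _ _) xo; have /= := allP no x xo; lia.
  - by rewrite so.
  - by rewrite lts.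
  (* The invariant survives because later preferences satisfy [b <= a], while the new spot satisfies
     [a <= s + k]. *)
  - move=> b x bp; rewrite inE => /orP[/eqP->|xo].
      have /= := allP pa b bp; lia.
    by apply: po => //; rewrite inE bp orbT.
  - by rewrite -addSnnS in sz.
have : n - (a - k) <= size occ.
  by apply: size_ge => s; rewrite mem_iota => s_in; apply: full; lia.
(* If [a < k], the truncated [a - k] is 0 and [szo] says that all [n] spots are taken, which [sz]
   excludes. *)
move=> szo; have -> // : a < n + k - size occ = false by lia.
Qed.

Lemma descending_naplesE (k n : nat) (t : n.-tuple 'I_n) :
  descending t -> naples k t = below (n + k) [seq val a | a <- t].
Proof.
move=> dt; rewrite /naples all_parkE //= ?subn0 ?size_map ?size_tuple //.
by apply/allP => x /mapP[i _ ->] /=.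
Qed.

(** * Counting weakly decreasing sequences under a bound *)

Fixpoint desc_below (l v b : nat) : seq (seq nat) :=
  if l is l'.+1 then
    [seq x :: s | x <- iota 0 (minn v b), s <- desc_below l' x.+1 b.-1]
  else [:: [::]].

Lemma mem_desc_below (l v b : nat) (s : seq nat) :
  (s \in desc_below l v b) =
  [&& size s == l, all (gtn v) s, sorted geq s & below b s].
Proof.
elim: l v b s => [|l IHl] v b s; first by rewrite /= inE; case: s.
have geq_trans : transitive geq by move=> x y z /=; lia.
apply/allpairsPdep/idP => [[x [s' [+ + ->]]]|].
  rewrite mem_iota IHl /= => lt_x /and4P[/eqP-> lt_s' ss' bs'].
  rewrite eqxx path_sortedE // ss' bs' andbT.
  apply/and4P; split; try lia.
  - by apply/andP; split; [lia | apply: sub_all lt_s' => y /=; lia].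
  - by rewrite ?andbT; apply: sub_all lt_s' => y /=; lia.
case: s => [|x s] //= /and4P[sz /andP[lt_xv sv]].
rewrite path_sortedE // => /andP[sx ss] /andP[lt_xb bs].
exists x, s; split=> //; first by rewrite mem_iota; lia.
by rewrite IHl ss bs -(eqn_add2r 1) !addn1 sz !andbT.
Qed.

Lemma desc_below_uniq (l v b : nat) : uniq (desc_below l v b).
Proof.
elim: l v b => //= l IHl v b; apply: allpairs_uniq_dep; first exact: iota_uniq.
  by move=> x _; apply: IHl.
by move=> [x s] [y u] _ _ /= [-> ->].
Qed.

(** The sequences are split by whether their first entry is the new value [v], which the bound
    admits since [v < b]. *)
Lemma size_desc_belowS (l v b : nat) : v < b ->
  size (desc_below l.+1 v.+1 b) =
  size (desc_below l.+1 v b) + size (desc_below l v.+1 b.-1).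
Proof.
move=> lt_vb /=; rewrite !size_allpairs_dep.
have -> : minn v.+1 b = v + 1 by lia.
have -> : minn v b = v by lia.
by rewrite iotaD map_cat sumn_cat /= addn0.
Qed.

Lemma desc_below_minn (l v b : nat) :
  desc_below l v b = desc_below l (minn v b) b.
Proof. by case: l => //= l; rewrite -minnA minnn. Qed.

(* The reflection principle: C(l + v - 1, l) counts all weakly decreasing
   sequences and C(l + v - 1, b + 1) those violating the bound. *)
Lemma size_desc_below (l v b : nat) : v <= b.+1 -> l <= b.+1 ->
  size (desc_below l v b) + 'C((l + v).-1, b.+1) = 'C((l + v).-1, l).
Proof.
elim: l v b => [|l IHl] v b.
  move=> le_v _; rewrite add0n bin0 /= bin_small //; lia.
elim: v => [|v IHv] le_v le_l.
  by rewrite /= addn0 min0n !bin_small.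
have [lt_vb|le_bv] := ltnP v b.
  rewrite size_desc_belowS //.
  have := IHv (ltnW le_v) le_l; have := IHl v.+1 b.-1.
  have -> : b.-1.+1 = b by lia.
  move=> /(_ lt_vb le_l).
  have -> : (l.+1 + v.+1).-1 = (l + v).+1 by lia.
  have -> : (l + v.+1).-1 = l + v by lia.
  have -> : (l.+1 + v).-1 = l + v by lia.
  rewrite !binS; lia.
(* On the boundary, raising [v] from [b] to [b.+1] adds no sequence. The terms that Pascal's rule
   adds on the two sides, ['C(l + b, b)] and ['C(l + b, l)], agree by symmetry. *)
have Ev : v = b by lia.
rewrite {le_bv le_v v}Ev in IHv *.
rewrite desc_below_minn (minn_idPr (leqnSn b)).
have := IHv (leqnSn b) le_l.
have -> : (l.+1 + b.+1).-1 = (l + b).+1 by lia.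
have -> : (l.+1 + b).-1 = l + b by lia.
rewrite !binS.
have -> : 'C(l + b, b) = 'C(l + b, l) by rewrite -bin_sub ?leq_addl ?addnK.
lia.
Qed.

Lemma card_desc_below (n b : nat) : 0 < n ->
  #|[pred t : n.-tuple 'I_n | descending t & below b [seq val a | a <- t]]| =
  size (desc_below n n b).
Proof.
case: n => // n _; pose f (t : n.+1.-tuple 'I_n.+1) := [seq val a | a <- t].
have f_inj : injective f by move=> t u /(inj_map val_inj)/val_inj.
rewrite cardE -(size_map f); apply/perm_size/uniq_perm.
- by rewrite map_inj_uniq ?enum_uniq.
- exact: desc_below_uniq.
move=> s; rewrite mem_desc_below; apply/mapP/and4P => [[t]|[sz sn ss sb]].
  rewrite mem_enum inE => /andP[dt bt] ->; split=> //.
    by rewrite size_map size_tuple.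
  by apply/allP => x /mapP[i _ ->] /=.
have sz' : size (map (@inord n) s) == n.+1 by rewrite size_map.
have fE : s = f (Tuple sz').
  rewrite /f /= -map_comp -[LHS]map_id; apply/eq_in_map => x xs /=.
  by rewrite inordK //; apply: (allP sn x xs).
by exists (Tuple sz') => //; rewrite mem_enum inE /descending -/(f _) -fE ss.
Qed.

(** The sequences below [(n + k).-1] are among those below [n + k], so the count is a difference of
    two instances of [size_desc_below], in which ['C((n + n).-1, n)] cancels. *)
Lemma card_desc_strictly_naples (k n : nat) : 0 < k -> 0 < n ->
  #|[pred t : n.-tuple 'I_n | descending t && strictly_naples k t]| +
    'C((n + n).-1, (n + k).+1) = 'C((n + n).-1, n + k).
Proof.
move=> k_gt0 n_gt0.
pose D b := [pred t : n.-tuple 'I_n |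
  descending t & below b [seq val a | a <- t]].
have szD b : n <= b.+1 -> #|D b| + 'C((n + n).-1, b.+1) = 'C((n + n).-1, n).
  by move=> le_nb; rewrite card_desc_below // size_desc_below.
rewrite (eq_card (B := [predD D (n + k) & D (n + k).-1])); last first.
  move=> t; rewrite !inE; case: (boolP (descending t)) => //= dt.
  rewrite /strictly_naples !descending_naplesE // andbC.
  by have -> : n + k.-1 = (n + k).-1 by lia.
have := cardID (D (n + k).-1) (D (n + k)).
have /eq_card -> : [predI D (n + k) & D (n + k).-1] =i D (n + k).-1.
  move=> t; rewrite !inE; case: (descending t) => //=.
  rewrite andb_idl //; apply: below_leq; lia.
have := szD (n + k); have := szD (n + k).-1.
have -> : (n + k).-1.+1 = n + k by lia.
set X := #|[predD _ & _]|; set Y := #|D _|; set Z := #|D _|; lia.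
Qed.

(** * Set partitions as kernels of labellings *)

(** A partition is handled as the fibres of a labelling. Blocks are then merged and split by
    changing labels, and only equality of labels matters, whatever their type. *)
Definition same_kernel (X : Type) (T U : eqType) (f : X -> T) (g : X -> U) :=
  forall x y, (f x == f y) = (g x == g y).

Lemma same_kernel_trans (X : Type) (T U V : eqType)
    (f : X -> T) (g : X -> U) (h : X -> V) :
  same_kernel f g -> same_kernel g h -> same_kernel f h.
Proof. by move=> fg gh x y; rewrite fg. Qed.

Lemma same_kernel_preim_partition (X : finType) (T U : eqType)
    (f : X -> T) (g : X -> U) :
  same_kernel f g -> preim_partition f setT = preim_partition g setT.
Proof.
move=> fg; apply: eq_imset => x; apply/setP => y.
by rewrite !inE fg.
Qed.

Lemma pblock_preim_partition (X : finType) (T : eqType) (f : X -> T) (x : X) :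
  pblock (preim_partition f setT) x = [set y | f y == f x].
Proof.
apply/setP => y; rewrite pblock_equivalence_partition ?inE // 1?eq_sym //.
by move=> a b c _ _ _; split=> // /eqP->.
Qed.

Lemma same_kernel_pblock (X : finType) (T : eqType) (f : X -> T) :
  same_kernel (pblock (preim_partition f setT)) f.
Proof.
have /and3P[/eqP cP tP _] := preim_partitionP f setT.
by move=> x y; rewrite eq_pblock ?cP ?inE // pblock_preim_partition inE eq_sym.
Qed.

Lemma preim_partition_pblock (X : finType) (P : {set {set X}}) :
  partition P setT -> preim_partition (pblock P) setT = P.
Proof.
move=> pP; rewrite -[RHS](equivalence_partition_pblock pP).
have /and3P[/eqP cP tP _] := pP.
apply: eq_imset => x; apply/setP => y.
by rewrite !inE eq_pblock ?cP ?inE.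
Qed.

(** Every block is the fibre through any of its points, so distinct blocks amount to distinct labels
    and the quantifiers over blocks disappear. *)
Lemma nc_partition_preimP (m : nat) (T : eqType) (f : 'I_m -> T) :
  reflect (forall a b c d : 'I_m, a < b -> b < c -> c < d ->
             f a = f c -> f b = f d -> f a = f b)
          (nc_partition (preim_partition f setT)).
Proof.
rewrite /nc_partition preim_partitionP /=.
have inP x : [set y | f y == f x] \in preim_partition f setT.
  rewrite -pblock_preim_partition pblock_mem //.
  by have /and3P[/eqP-> _ _] := preim_partitionP f setT.
have memP B x : B \in preim_partition f setT -> x \in B ->
    B = [set y | f y == f x].
  have /and3P[_ tP _] := preim_partitionP f setT.
  by move=> BP xB; rewrite -pblock_preim_partition (def_pblock tP BP xB).
apply: (iffP idP) => [nc a b c d ab bc cd fac fbd|nc].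
  apply/eqP/negPn/negP => fab.
  move/forall_inP: nc => /(_ _ (inP a))/forall_inP/(_ _ (inP b))/implyP.
  have nAB : [set y | f y == f a] != [set y | f y == f b].
    apply/negP => /eqP/setP/(_ a).
    by rewrite !inE eqxx (negPf fab).
  move=> /(_ nAB)/negP; apply.
  apply/exists_inP; exists a; rewrite ?inE //.
  apply/exists_inP; exists b; rewrite ?inE //.
  apply/exists_inP; exists c; rewrite ?inE ?fac //.
  by apply/exists_inP; exists d; rewrite ?inE ?fbd ?ab ?bc ?cd.
apply/forall_inP => B BP; apply/forall_inP => C CP; apply/implyP.
apply: contraNN.
move=> /exists_inP[a aB /exists_inP[b bC /exists_inP[c cB /exists_inP[d dC]]]].
move=> /and3P[ab bc cd]; apply/eqP.
move: cB dC; rewrite (memP _ _ BP aB) (memP _ _ CP bC) !inE => /eqP ca /eqP db.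
by rewrite (nc a b c d).
Qed.

(** * Deleting and restoring the first point *)

(** [lift ord0] embeds the points that remain after the deletion; [lift ord0 ord0] is the former
    second point. *)
Definition merge_first (m : nat) (T : eqType) (f : 'I_m.+2 -> T)
    (i : 'I_m.+1) : T :=
  if f (lift ord0 i) == f ord0 then f (lift ord0 ord0) else f (lift ord0 i).

(* The last r elements of the first block. *)
Definition top_first (m : nat) (T : eqType) (r : nat)
    (g : 'I_m.+1 -> T) : pred 'I_m.+1 :=
  fun i => (g i == g ord0) && (#|[pred j | g j == g ord0 & i <= j]| <= r).

(* Adding a new first point, in one block with the last r elements of the
   former first block. *)
Definition split_first (m : nat) (T : eqType) (r : nat) (g : 'I_m.+1 -> T)
    (x : 'I_m.+2) : option T :=
  if unlift ord0 x is Some i then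
    if top_first r g i then None else Some (g i)
  else None.

Lemma split_first0 (m : nat) (T : eqType) r (g : 'I_m.+1 -> T) :
  split_first r g ord0 = None.
Proof. by rewrite /split_first unlift_none. Qed.

Lemma split_first_lift (m : nat) (T : eqType) r (g : 'I_m.+1 -> T) i :
  split_first r g (lift ord0 i) = if top_first r g i then None else Some (g i).
Proof. by rewrite /split_first liftK. Qed.

(** Labels are only compared and copied, so the operation is well defined on partitions. *)
Lemma same_kernel_merge_first (m : nat) (T U : eqType)
    (f : 'I_m.+2 -> T) (g : 'I_m.+2 -> U) :
  same_kernel f g -> same_kernel (merge_first f) (merge_first g).
Proof.
move=> fg i j; rewrite /merge_first !fg.
by case: ifP => _; case: ifP => _; rewrite fg.
Qed.

Lemma same_kernel_split_first (m : nat) (T U : eqType) r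
    (f : 'I_m.+1 -> T) (g : 'I_m.+1 -> U) :
  same_kernel f g -> same_kernel (split_first r f) (split_first r g).
Proof.
move=> fg x y; rewrite /split_first.
have top i : top_first r f i = top_first r g i.
  rewrite /top_first fg; congr (_ && (_ <= r)).
  by apply: eq_card => j; rewrite !inE fg.
case: (unlift ord0 x) => [i|]; case: (unlift ord0 y) => [j|] //=;
  rewrite ?top; do ?[case: ifP => _ //].
exact: fg.
Qed.

Lemma top_first_up (m : nat) (T : eqType) r (g : 'I_m.+1 -> T) (i j : 'I_m.+1) :
  top_first r g i -> i <= j -> g j = g ord0 -> top_first r g j.
Proof.
move=> /andP[_ le_r] le_ij gj; rewrite /top_first gj eqxx.
apply: leq_trans le_r; apply/subset_leq_card/subsetP => l.
by rewrite !inE => /andP[-> /(leq_trans le_ij)].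
Qed.

(** Merging glues the class of [ord0] to that of the second point [o]. A crossing that relies on the
    gluing yields one for [f] in which [ord0] or [o], at the far left, replaces [a] or [d]. *)
Lemma nc_merge_first (m : nat) (T : eqType) (f : 'I_m.+2 -> T) :
  nc_partition (preim_partition f setT) ->
  nc_partition (preim_partition (merge_first f) setT).
Proof.
move=> /nc_partition_preimP nc; apply/nc_partition_preimP => a b c d ab bc cd.
pose o : 'I_m.+2 := lift ord0 ord0.
have lb (x y : 'I_m.+1) : x < y -> lift ord0 x < lift ord0 y by [].
have zlt (x : 'I_m.+1) : (ord0 : 'I_m.+2) < lift ord0 x by [].
have olt (x y : 'I_m.+1) : x < y -> o < lift ord0 y.
  by rewrite /o /lift /= /bump /=; lia.
rewrite /merge_first -/o.
have h := nc _ _ _ _ (lb _ _ ab) (lb _ _ bc) (lb _ _ cd).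
have h0 := nc _ _ _ _ (zlt b) (lb _ _ bc) (lb _ _ cd).
have h1 := nc _ _ _ _ (olt _ _ ab) (lb _ _ bc) (lb _ _ cd).
have h2 := nc _ _ _ _ (zlt a) (lb _ _ ab) (lb _ _ bc).
(* [a] may be the second point itself; then [lift ord0 a] is [o]. *)
have h3 : o < lift ord0 a \/ a = ord0.
  case: (posnP a) => a0; last by left; apply: (olt ord0).
  by right; apply: val_inj.
have {}h3 : f o = f (lift ord0 b) -> f (lift ord0 a) = f (lift ord0 c) ->
    f o = f (lift ord0 a).
  by case: h3 => [oa|-> //]; apply: nc (lb _ _ ab) (lb _ _ bc).
by do 4![case: eqP => ?] => ? ?; first
  [ congruence
  | have := h ltac:(congruence) ltac:(congruence); congruence
  | have := h0 ltac:(congruence) ltac:(congruence); congruence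
  | have := h1 ltac:(congruence) ltac:(congruence); congruence
  | have := h2 ltac:(congruence) ltac:(congruence); congruence
  | have := h3 ltac:(congruence) ltac:(congruence); congruence ].
Qed.

(** A crossing has to involve the new block and, as [g] has none, the rest of the former first
    block. But [top_first] cuts that block into an initial and a final segment, and these do not
    interleave, even with the new leftmost point added to the final one. *)
Lemma nc_split_first (m : nat) (T : eqType) r (g : 'I_m.+1 -> T) :
  nc_partition (preim_partition g setT) ->
  nc_partition (preim_partition (split_first r g) setT).
Proof.
move=> /nc_partition_preimP nc; apply/nc_partition_preimP => a b c d ab bc cd.
case: (unliftP ord0 d) => [d' Ed|Ed]; last by rewrite Ed in cd.
case: (unliftP ord0 c) => [c' Ec|Ec]; last by rewrite Ec in bc.
case: (unliftP ord0 b) => [b' Eb|Eb]; last by rewrite Eb in ab.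
rewrite {b}Eb {c}Ec {d}Ed in ab bc cd *; rewrite !split_first_lift.
have {}bc : b' < c' by [].
have {}cd : c' < d' by [].
have topE x : top_first r g x -> g x = g ord0 by case/andP=> /eqP.
case: (unliftP ord0 a) => [a' Ea|Ea]; rewrite {a}Ea in ab *; last first.
  rewrite split_first0.
  case: (boolP (top_first r g c')) => // tc _.
  case: (boolP (top_first r g b')) => // tb.
  case: (boolP (top_first r g d')) => // td [] gbd.
  (* The new point has no [g]-label. The former first point, in the same [g]-block as [c'], replaces
     it unless it is [b'] itself. *)
  case: (posnP b') => [b0|b0].
    have {}b0 : b' = ord0 by apply: val_inj.
    by case/negP: td; apply: top_first_up (ltnW cd) _; rewrite // -gbd b0.
  have g0b : g ord0 = g b' by apply: (nc ord0 b' c' d'); rewrite // topE.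
  by case/negP: td; apply: top_first_up (ltnW cd) _; rewrite // -gbd.
have {}ab : a' < b' by [].
rewrite split_first_lift.
case: (boolP (top_first r g a')) => ta;
  case: (boolP (top_first r g c')) => tc //.
  move=> _.
  case: (boolP (top_first r g b')) => // tb.
  case: (boolP (top_first r g d')) => // td [] gbd.
  have gab : g a' = g b' by apply: nc ab bc cd _ gbd; rewrite !topE.
  by case/negP: tb; apply: top_first_up (ltnW ab) _; rewrite // -gab topE.
move=> [] gac.
case: (boolP (top_first r g b')) => tb;
  case: (boolP (top_first r g d')) => td //.
  move=> _.
  have gab : g a' = g b' by apply: nc ab bc cd gac _; rewrite !topE.
  by case/negP: tc; apply: top_first_up (ltnW bc) _; rewrite // -gac gab topE.
by move=> [] gbd; congr Some; apply: nc ab bc cd gac gbd.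
Qed.

Lemma card_ord_recl (n : nat) (p : pred 'I_n.+1) :
  #|[pred x | p x]| = p ord0 + #|[pred i | p (lift ord0 i)]|.
Proof.
rewrite -!sum1_card big_mkcond big_ord_recl [in RHS]big_mkcond /=.
by rewrite inE; case: (p ord0).
Qed.

(** Induction by removing the smallest point: this changes no count for the others, and that point
    is selected only if all points of [p] are. *)
Lemma card_top (n r : nat) (p : pred 'I_n) :
  #|[pred i | p i & #|[pred j | p j & i <= j]| <= r]| =
  minn r #|[pred i | p i]|.
Proof.
elim: n p => [|n IHn] p; first by rewrite !eq_card0 ?minn0 // => -[].
rewrite card_ord_recl (card_ord_recl p) /=.
have -> : #|[pred j | p j & (ord0 : 'I_n.+1) <= j]| = #|[pred j | p j]|.
  by apply: eq_card => j; rewrite !inE leq0n andbT.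
rewrite (card_ord_recl p).
have lE (i : 'I_n) : #|[pred j | p j & lift ord0 i <= j]| =
    #|[pred j | p (lift ord0 j) & i <= j]|.
  by rewrite (card_ord_recl (fun j => p j && (lift ord0 i <= j))) andbF.
have := IHn (fun i => p (lift ord0 i)); rewrite -(eq_card (A := [pred i |
  p (lift ord0 i) & #|[pred j | p j & lift ord0 i <= j]| <= r])); last first.
  by move=> i; rewrite !inE lE.
move=> ->.
by case: (p ord0) => /=; lia.
Qed.

Lemma merge_splitK (m : nat) (T : eqType) r (g : 'I_m.+1 -> T) :
  same_kernel (merge_first (split_first r g)) g.
Proof.
(* The common label of the former first block is [None] if that block was split off entirely and
   [Some (g ord0)] otherwise; no other block carries it. *)
have mE i : merge_first (split_first r g) i =
    if g i == g ord0 then split_first r g (lift ord0 ord0) else Some (g i).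
  rewrite /merge_first split_first0 !split_first_lift.
  case: (boolP (top_first r g i)) => [/andP[-> _]|ti]; first by rewrite eqxx.
  rewrite /=; case: eqP => [gi|//]; case: ifP => [t0|_]; last by rewrite gi.
  by rewrite (top_first_up t0) in ti.
move=> i j; rewrite !mE split_first_lift.
case: (g i =P g ord0) => [->|gi]; case: (g j =P g ord0) => [->|gj];
  rewrite ?eqxx //.
  by case: ifP => _ //=; apply/esym/eqP => /esym.
by case: ifP => _ //=; apply/esym/eqP.
Qed.

Lemma split_mergeK (m : nat) (T : eqType) r (f : 'I_m.+2 -> T) :
    nc_partition (preim_partition f setT) ->
    #|[pred x | f x == f ord0]| = r.+1 ->
  same_kernel (split_first r (merge_first f)) f.
Proof.
move=> /nc_partition_preimP nc.
rewrite card_ord_recl eqxx => -[] card_f0.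
pose o : 'I_m.+2 := lift ord0 ord0.
have m0 i : (merge_first f i == merge_first f ord0) =
    (f (lift ord0 i) == f ord0) || (f (lift ord0 i) == f o).
  by rewrite /merge_first -/o if_same; case: (_ =P f ord0); rewrite ?eqxx.
(* The heart of the inverse: if the blocks of [ord0] and [o] differ, non-crossing puts the whole
   block of [o] before the other [r] points of the block of [ord0], so these are the last [r] of the
   merged block. *)
have topE i : top_first r (merge_first f) i = (f (lift ord0 i) == f ord0).
  rewrite /top_first m0; case: (_ =P f ord0) => fi /=.
    rewrite -[X in _ <= X]card_f0; apply/subset_leq_card/subsetP => j.
    rewrite !inE m0 => /andP[/orP[] // fj le_ij].
    case: (eqVneq (f ord0) (f o)) => [->//|/eqP f0o].
    case: (posnP i) => [i0|i0].
      by case: f0o; rewrite -fi; congr (f _); apply: val_inj; rewrite /= i0.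
    case: (eqVneq i j) => [<-|ij]; first by rewrite fi eqxx.
    case: f0o; apply: (nc ord0 o (lift ord0 i) (lift ord0 j)) => //.
    - by rewrite ltn_neqAle ij in le_ij *.
    - by rewrite (eqP fj).
  case: eqP => //= fi1; apply/negbTE; rewrite -ltnNge -[X in X < _]card_f0.
  have {}nc (j : 'I_m.+1) : f (lift ord0 j) = f ord0 -> i < j.
    move=> fj; rewrite ltnNge; apply/negP => le_ji.
    have ji : j != i by apply/eqP => ji; rewrite -ji in fi.
    have lt_ji : lift ord0 j < lift ord0 i.
      by rewrite ltnS ltn_neqAle ji.
    case: (posnP j) => j0.
      apply: fi; rewrite fi1 -fj; congr (f _).
      by apply: val_inj; rewrite /= j0.
    apply: fi; rewrite fi1; apply/esym.
    exact: (nc ord0 o (lift ord0 j) (lift ord0 i)).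
  (* From [i] on, the merged block contains those [r] points and also [i] itself, hence more than
     [r]. *)
  apply: proper_card; apply/properP; split.
    apply/subsetP => j; rewrite !inE m0 => /eqP fj.
    by rewrite fj eqxx /= ltnW ?nc.
  exists i; last by rewrite inE; apply/eqP.
  by rewrite inE m0 leqnn fi1 eqxx orbT.
have sE x : split_first r (merge_first f) x =
    if f x == f ord0 then None else Some (f x).
  case: (unliftP ord0 x) => [i|] ->; last by rewrite split_first0 eqxx.
  by rewrite split_first_lift topE /merge_first; case: (_ == _).
move=> x y; rewrite !sE.
case: (f x =P f ord0) => [->|fx]; case: (f y =P f ord0) => [->|fy] //.
- by rewrite !eqxx.
- by apply/esym/eqP => /esym.
- by apply/esym/eqP.
Qed.

Lemma card_block_merge_first (m : nat) (T : eqType) (f : 'I_m.+2 -> T) :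
  #|[pred x | f x == f ord0]| <=
  #|[pred i | merge_first f i == merge_first f ord0]|.+1.
Proof.
rewrite card_ord_recl eqxx add1n ltnS; apply/subset_leq_card/subsetP => i.
by rewrite !inE /merge_first if_same => ->; rewrite eqxx.
Qed.

Lemma card_block_split_first (m : nat) (T : eqType) r (g : 'I_m.+1 -> T) :
  r <= #|[pred i | g i == g ord0]| ->
  #|[pred x | split_first r g x == split_first r g ord0]| = r.+1.
Proof.
move=> le_r; rewrite card_ord_recl eqxx add1n; congr _.+1.
rewrite -[RHS](minn_idPl le_r) -card_top; apply: eq_card => i.
by rewrite !inE split_first0 split_first_lift -/(top_first r g i); case: ifP.
Qed.

(** * Counting non-crossing partitions by the size of the first block *)

Lemma leq_card_in_on (T U : finType) (A : {pred T}) (B : {pred U})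
    (f : T -> U) :
  {in A, forall x, f x \in B} -> {in A &, injective f} -> #|A| <= #|B|.
Proof.
move=> AB f_inj; rewrite -(card_in_imset f_inj); apply/subset_leq_card.
by apply/subsetP => _ /imsetP[x xA ->]; apply: AB.
Qed.

Definition nc_first_eq (m r : nat) : pred {set {set 'I_m.+1}} :=
  fun P => nc_partition P && (#|pblock P ord0| == r).

Definition nc_first_geq (m r : nat) : pred {set {set 'I_m.+1}} :=
  fun P => nc_partition P && (r <= #|pblock P ord0|).

Arguments nc_first_eq : clear implicits.
Arguments nc_first_geq : clear implicits.

Lemma card_nc_first_eqS (m r : nat) :
  #|nc_first_eq m.+1 r.+1| = #|nc_first_geq m r|.
Proof.
have ncK n (P : {set {set 'I_n}}) : nc_partition P ->
    preim_partition (pblock P) setT = P.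
  by case/andP=> /preim_partition_pblock.
have cE n (P : {set {set 'I_n.+1}}) : nc_partition P ->
    #|pblock P ord0| = #|[pred x | pblock P x == pblock P ord0]|.
  move=> /ncK PK; rewrite -{1}PK pblock_preim_partition.
  by apply: eq_card => x; rewrite !inE.
have cP n (T : eqType) (f : 'I_n.+1 -> T) :
    #|pblock (preim_partition f setT) ord0| = #|[pred x | f x == f ord0]|.
  by rewrite pblock_preim_partition; apply: eq_card => x; rewrite !inE.
pose M (P : {set {set 'I_m.+2}}) :=
  preim_partition (merge_first (pblock P)) setT.
pose S (P : {set {set 'I_m.+1}}) :=
  preim_partition (split_first r (pblock P)) setT.
have MS : {in nc_first_eq m.+1 r.+1, cancel M S}.
  move=> P /andP[ncP /eqP]; rewrite cE // => cardP.
  rewrite -[RHS](ncK _ P ncP); apply: same_kernel_preim_partition.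
  (* [pblock] of the merged partition has the kernel of the merged labelling, so the inversion can
     be checked on labels. *)
  apply: same_kernel_trans.
    exact/same_kernel_split_first/same_kernel_pblock.
  by apply: split_mergeK => //; rewrite ncK.
have SM : {in nc_first_geq m r, cancel S M}.
  move=> P /andP[ncP _].
  rewrite -[RHS](ncK _ P ncP); apply: same_kernel_preim_partition.
  apply: same_kernel_trans.
    exact/same_kernel_merge_first/same_kernel_pblock.
  exact: merge_splitK.
apply/eqP; rewrite eqn_leq; apply/andP; split.
  apply: leq_card_in_on (can_in_inj MS) => P /andP[ncP /eqP].
  rewrite cE // => cardP; apply/andP; split.
    by apply: nc_merge_first; rewrite ncK.
  by rewrite cP -ltnS -cardP card_block_merge_first.
apply: leq_card_in_on (can_in_inj SM) => P /andP[ncP].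
rewrite cE // => le_r; apply/andP; split.
  by apply: nc_split_first; rewrite ncK.
by rewrite cP card_block_split_first.
Qed.

Lemma card_nc_first_geq_rec (m r : nat) :
  #|nc_first_geq m r| = #|nc_first_eq m r| + #|nc_first_geq m r.+1|.
Proof.
rewrite -(cardID (nc_first_geq m r.+1)) addnC; congr (_ + _).
  apply: eq_card => P; rewrite !inE /nc_first_eq /nc_first_geq.
  by case: (nc_partition P) => //=; lia.
apply: eq_card => P; rewrite !inE /nc_first_geq.
by case: (nc_partition P) => //=; lia.
Qed.

Lemma card_nc_first_geq_small (m r : nat) : m.+1 < r -> #|nc_first_geq m r| = 0.
Proof.
move=> lt_r; apply: eq_card0 => P; rewrite !inE /nc_first_geq.
apply/negP => /andP[_] /leq_trans/(_ (max_card _)); rewrite card_ord; lia.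
Qed.

Lemma card_pblock_gt0 (m : nat) (P : {set {set 'I_m.+1}}) :
  nc_partition P -> 0 < #|pblock P ord0|.
Proof.
case/andP=> /and3P[/eqP cP _ _] _; apply/card_gt0P; exists ord0.
by rewrite mem_pblock cP inE.
Qed.

Lemma card_nc_first_geq0 (m : nat) : #|nc_first_geq m 0| = #|nc_first_geq m 1|.
Proof.
apply: eq_card => P; rewrite !unfold_in /nc_first_geq.
by case: (boolP (nc_partition P)) => //= /card_pblock_gt0->.
Qed.

Lemma card_nc_first_eq1 : #|nc_first_eq 0 1| = 1.
Proof.
rewrite (eq_card (B := pred1 (preim_partition (@id 'I_1) setT))) ?card1 //.
move=> P; rewrite !inE unfold_in /nc_first_eq.
apply/idP/eqP => [/andP[/andP[pP _] _]|->].
  rewrite -(preim_partition_pblock pP).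
  apply: same_kernel_preim_partition => x y.
  by rewrite !ord1 !eqxx.
apply/andP; split; first by apply/nc_partition_preimP => a b; rewrite !ord1.
by rewrite pblock_preim_partition (eq_card (B := predT)) ?card_ord // => x;
  rewrite !inE !ord1.
Qed.

(** The assumed counts for exact sizes are summed from the largest size downwards; Pascal's rule
    makes the sum telescope. *)
Lemma card_nc_first_geq (m r : nat) :
    (forall s, 0 < s <= m.+1 ->
     #|nc_first_eq m s| + 'C(2 * m + 1 - s, m.+1) = 'C(2 * m + 1 - s, m)) ->
    r <= m.+2 ->
  #|nc_first_geq m r| + 'C(2 * m + 2 - r, m.+2) = 'C(2 * m + 2 - r, m.+1).
Proof.
move=> cardA le_r.
(* Descending induction on the size [m.+2 - s], from [m.+2], which no block of [m.+1] points
   attains, down to 1. *)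
have W1 s : s <= m.+1 -> #|nc_first_geq m (m.+2 - s)| +
    'C(2 * m + 2 - (m.+2 - s), m.+2) = 'C(2 * m + 2 - (m.+2 - s), m.+1).
  elim: s => [|s IHs] le_s.
    rewrite card_nc_first_geq_small ?bin_small //; lia.
  rewrite card_nc_first_geq_rec.
  have -> : (m.+2 - s.+1).+1 = m.+2 - s by lia.
  have := IHs (ltnW le_s); have := cardA (m.+2 - s.+1).
  have -> : 2 * m + 1 - (m.+2 - s.+1) = 2 * m + 2 - (m.+2 - s) by lia.
  have -> : 2 * m + 2 - (m.+2 - s.+1) = (2 * m + 2 - (m.+2 - s)).+1 by lia.
  rewrite !binS; lia.
case: r le_r => [_|r le_r].
  (* Sizes 0 and 1 give the same set, and the formula agrees there since ['C((2 * m).+1, m.+1)]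
     equals ['C((2 * m).+1, m)]. *)
  rewrite card_nc_first_geq0 subn0.
  have := W1 m.+1 (leqnn _); have -> : m.+2 - m.+1 = 1 by lia.
  have -> : 2 * m + 2 - 1 = (2 * m).+1 by lia.
  have -> : 2 * m + 2 = (2 * m).+2 by lia.
  rewrite ![in 'C((2 * m).+2, _)]binS.
  have -> : 'C((2 * m).+1, m.+1) = 'C((2 * m).+1, m).
    rewrite -bin_sub; last by lia.
    by congr 'C(_, _); lia.
  lia.
have := W1 (m.+2 - r.+1); have -> : m.+2 - (m.+2 - r.+1) = r.+1 by lia.
by apply; lia.
Qed.

(** These are ballot numbers. Removing the first point turns an exact size at [m.+1] into a lower
    bound at [m], where the induction hypothesis is summed. *)
Lemma card_nc_first_eq (m r : nat) : 0 < r <= m.+1 ->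
  #|nc_first_eq m r| + 'C(2 * m + 1 - r, m.+1) = 'C(2 * m + 1 - r, m).
Proof.
elim: m r => [|m IHm] r.
  by move=> ?; have -> : r = 1 by [lia]; rewrite card_nc_first_eq1.
case: r => // r le_r; rewrite card_nc_first_eqS.
have -> : 2 * m.+1 + 1 - r.+1 = 2 * m + 2 - r by lia.
by apply: card_nc_first_geq => //; lia.
Qed.

(** * Rooted partitions and comparison of the two counts *)

(** The root must be the block of [ord0], so it can be forgotten and recovered. *)
Lemma card_rooted_nc_partition_at_1 (r m : nat) :
  #|[pred Q : {set {set 'I_m.+1}} * {set 'I_m.+1} |
      rooted_nc_partition r Q && (ord0 \in Q.2)]| = #|nc_first_eq m r|.
Proof.
apply/eqP; rewrite eqn_leq; apply/andP; split.
  have QE (Q : {set {set 'I_m.+1}} * {set 'I_m.+1}) :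
      rooted_nc_partition r Q && (ord0 \in Q.2) -> Q.2 = pblock Q.1 ord0.
    case/andP=> /and3P[/andP[/and3P[_ tP _] _] QP _] Q0.
    by rewrite (def_pblock tP QP Q0).
  apply: (@leq_card_in_on _ _ _ _ fst) => [Q QP|Q R /QE + /QE].
    have := QE Q QP; case/andP: QP => /and3P[nQ _ /eqP <-] _ QE'.
    by rewrite unfold_in /nc_first_eq nQ -QE' eqxx.
  by case: Q R => [Q1 Q2] [R1 R2] /= -> -> ->.
apply: (@leq_card_in_on _ _ _ _ (fun P => (P, pblock P ord0))).
  move=> P /andP[nP cP]; rewrite inE /rooted_nc_partition /= nP cP.
  case/andP: nP => /and3P[/eqP covP _ _] _.
  by rewrite mem_pblock pblock_mem covP inE.
by move=> P Q _ _ [].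
Qed.

Lemma eq_card_bijective (T U : finType) : #|T| = #|U| ->
  exists f : T -> U, bijective f.
Proof.
move=> eTU; exists (enum_val \o cast_ord eTU \o enum_rank).
apply: bij_comp; last exact: enum_rank_bij.
apply: bij_comp; first exact: enum_val_bij.
exact: (Bijective (cast_ordK eTU) (cast_ordKV eTU)).
Qed.

Theorem theorem6p4 (k n : nat) (hk : 0 < k) (hn : 0 < n) :
  exists f : desc_strictly_naples k n ->
             rooted_nc_partition_at_1 (2 * k + 2) (n + k),
    bijective f.
Proof.
apply: eq_card_bijective; rewrite !card_sig card_rooted_nc_partition_at_1.
have := card_desc_strictly_naples hk hn; set X := #|_|.
(* A block of size [2 * k + 2] fits into [n + k + 1] points exactly when [k < n]; the two binomial
   differences then coincide. *)
have [lt_kn|le_nk] := ltnP k n.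
  have := @card_nc_first_eq (n + k) (2 * k + 2).
  have -> : 2 * (n + k) + 1 - (2 * k + 2) = (n + n).-1 by lia.
  set Y := #|_|; lia.
(* For [n <= k] both sides are empty: the root is too large, and [(n + n).-1 < n + k] makes the
   binomials vanish. *)
rewrite !bin_small; try lia.
have : #|nc_first_eq (n + k) (2 * k + 2)| <=
    #|nc_first_geq (n + k) (2 * k + 2)|.
  by rewrite (card_nc_first_geq_rec _ (2 * k + 2)) leq_addr.
rewrite card_nc_first_geq_small; [set Y := #|_|; lia | lia].
Qed.
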